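(* Let $\Gamma$ be a lattice in $\mathbb{R}^d$ and $x\in\mathbb{R}^d$. Then \[\mathrm{OC}(x+\Gamma)=\{R\in \mathrm{OC}(\Gamma): Rx-x\in\Gamma+R\Gamma\}.\] In addition, if $R\in \mathrm{OC}(x+\Gamma)$ with $Rx-x\in\ell+R\Gamma$ for some $\ell\in\Gamma$, then \[(x+\Gamma)\cap R(x+\Gamma)=(x+\ell)+\Gamma(R).\]
   Context: A lattice in $\mathbb{R}^d$ is the $\mathbb{Z}$-span of $d$ linearly independent vectors of $\mathbb{R}^d$; a sublattice of $\Gamma$ is a subgroup of finite index. $\mathrm{OC}(\Gamma)$ is the set of linear coincidence isometries of $\Gamma$, i.e. of all $R\in \mathrm{O}(d)$ such that $\Gamma\cap R\Gamma$ has finite index in both $\Gamma$ and $R\Gamma$. For $R\in\mathrm{OC}(\Gamma)$, $\Gamma(R):=\Gamma\cap R\Gamma$. A cosublattice of the shifted lattice $x+\Gamma$ is a subset of the form $x+(\ell+\Gamma')$ with $\ell\in\Gamma$ and $\Gamma'$ a sublattice of $\Gamma$. $\mathrm{OC}(x+\Gamma)$ is the set of linear coincidence isometries of $x+\Gamma$, i.e. of all $R\in \mathrm{O}(d)$ such that $(x+\Gamma)\cap R(x+\Gamma)$ is a cosublattice of $x+\Gamma$ (here $R(x+\Gamma)=Rx+R\Gamma$). *)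

(* Defs.v *)
From HB Require Import structures.
From mathcomp Require Import all_boot all_order all_algebra.
From mathcomp Require Import classical_sets cardinality reals.

Set Implicit Arguments.
Unset Strict Implicit.
Unset Printing Implicit Defensive.

Import GRing.Theory.
Local Open Scope classical_set_scope.
Local Open Scope ring_scope.

Section Coincidence.
Variables (R : realType) (d : nat).
Implicit Types (x : 'cV[R]_d) (A : 'M[R]_d) (G H L : set 'cV[R]_d).

Definition translate x G : set 'cV[R]_d := [set x + g | g in G].

Definition sumset G H : set 'cV[R]_d := [set g + h | g in G & h in H].

Definition mximage A G : set 'cV[R]_d := [set A *m g | g in G].

Definition orthogonal_group : set 'M[R]_d := [set A | A^T *m A = 1%:M].

Definition is_lattice G : Prop :=
  exists2 b : d.-tuple 'cV[R]_d, free b &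
    G = [set \sum_(i < d) tnth b i *~ c i | c in [set: 'I_d -> int]].

(* The index of H in G is the number of distinct cosets g + H with g in G. *)
Definition has_finite_index G H : Prop :=
  H `<=` G /\ finite_set [set translate g H | g in G].

Definition is_sublattice G H : Prop :=
  zmod_closed (mem H) /\ has_finite_index G H.

Definition CSL G A : set 'cV[R]_d := G `&` mximage A G.

Definition OC G : set 'M[R]_d :=
  [set A | [/\ orthogonal_group A, has_finite_index G (CSL G A)
             & has_finite_index (mximage A G) (CSL G A)]].

Definition is_cosublattice x G L : Prop :=
  exists l H, [/\ G l, is_sublattice G H & L = translate x (translate l H)].

(* OC(x + G); the shift x and the lattice G are passed separately, here and in
   is_cosublattice (cosublattices of x + G). *)
Definition OC_shifted x G : set 'M[R]_d :=
  [set A | orthogonal_group A /\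
           is_cosublattice x G (translate x G `&` mximage A (translate x G))].

End Coincidence.

(* Main.v *)
Require Import Defs.
From mathcomp Require Import all_boot all_order all_algebra.
From mathcomp Require Import classical_sets cardinality reals.

(** Whether [A x - x] lies in [G + A G] only decides if [x + G] and [A (x + G)]
meet.  If they do, their intersection is a coset of the group [G `&` A G], by a
computation in the ambient group ([translate_mximage_meet]).  The coset equality
also identifies the sublattice [H] of a cosublattice [x + (l + H)] equal to this
intersection: [H] must be [G `&` A G].  Hence [A] is a coincidence isometry of
[x + G] exactly when the cosets meet and [G `&` A G] has finite index in [G].

The remaining point is that finite index of [G `&` A G] in [G] forces finite
index in [A G].  Finite index in [G] provides an [n > 0] with [n G] inside
[A G] ([finite_index_exponent]).  Writing [G = B Z^d], this says that
[n B = A B M] for an integer matrix [M]; multiplying by the adjugate of [M]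
gives [det M * A B = B (n adj M)], so a positive multiple of [A G] lies in [G]
([lattice_multiple_sym]).  A subgroup of a lattice that contains a positive
multiple of the lattice has finite index, because cosets are represented by
coordinate vectors reduced modulo that multiple
([finite_index_of_multiple]). *)

Set Implicit Arguments.
Unset Strict Implicit.
Unset Printing Implicit Defensive.

Import GRing.Theory Num.Theory.

Local Open Scope classical_set_scope.
Local Open Scope ring_scope.

(** * Subgroups and their cosets *)

Lemma zmod_closed_setP (V : zmodType) (H : set V) :
  zmod_closed (mem H) <-> H 0 /\ (forall u v, H u -> H v -> H (u - v)).
Proof.
split=> -[H0 HB]; split.
- by move: H0; rewrite inE.
- by move=> u v Hu Hv; move: (HB u v); rewrite !inE; apply.
- by rewrite inE.
- by move=> u v; rewrite !inE; exact: HB.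
Qed.

Section Subgroup.
Variables (V : zmodType) (H : set V) (subH : zmod_closed (mem H)).

Lemma subgroup0 : H 0.
Proof. by have /zmod_closed_setP[] := subH. Qed.

Lemma subgroupB u v : H u -> H v -> H (u - v).
Proof. by have /zmod_closed_setP[_] := subH; apply. Qed.

Lemma subgroupN u : H u -> H (- u).
Proof. by move=> Hu; rewrite -sub0r; apply: subgroupB => //; exact: subgroup0. Qed.

Lemma subgroupD u v : H u -> H v -> H (u + v).
Proof. by move=> Hu Hv; rewrite -[v]opprK; apply/subgroupB/subgroupN. Qed.

Lemma subgroupMn u n : H u -> H (u *+ n).
Proof.
move=> Hu; elim: n => [|n IHn]; first exact: subgroup0.
by rewrite mulrS; exact: subgroupD.
Qed.

End Subgroup.

Section Cosets.
Variables (R : realType) (d : nat).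
Implicit Types (x : 'cV[R]_d) (A B : 'M[R]_d) (G H L : set 'cV[R]_d).

Lemma translateP g H y : translate g H y <-> H (y - g).
Proof.
split=> [[h Hh <-]|Hy]; first by rewrite addrC addKr.
by exists (y - g) => //; rewrite addrC subrK.
Qed.

Lemma translateD x y H : translate x (translate y H) = translate (x + y) H.
Proof.
by apply/seteqP; split=> z; rewrite !translateP opprD addrA.
Qed.

Lemma translate_inj x : injective (translate x).
Proof.
move=> H L eqHL; apply/seteqP; split=> z Hz.
  have : translate x H (x + z) by exists z.
  by rewrite eqHL translateP addrC addKr.
have : translate x L (x + z) by exists z.
by rewrite -eqHL translateP addrC addKr.
Qed.

Lemma translate_eqP H g g' : zmod_closed (mem H) ->
  translate g H = translate g' H <-> H (g - g').
Proof.
move=> subH; split=> [eqH|Hg].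
  apply/translateP; rewrite -eqH; apply/translateP.
  by rewrite subrr; exact: subgroup0.
apply/seteqP; split=> z; rewrite !translateP => Hz.
  by rewrite -(subrKA g); exact: subgroupD.
by rewrite -(subrKA g'); apply: subgroupD => //; rewrite -opprB; exact: subgroupN.
Qed.

Lemma mximage_closed A G : zmod_closed (mem G) -> zmod_closed (mem (mximage A G)).
Proof.
move=> subG; apply/zmod_closed_setP; split.
  by exists 0; rewrite ?mulmx0//; exact: subgroup0.
move=> _ _ [u Gu <-] [v Gv <-].
by exists (u - v); rewrite ?mulmxBr//; exact: subgroupB.
Qed.

Lemma CSL_closed A G : zmod_closed (mem G) -> zmod_closed (mem (CSL G A)).
Proof.
move=> subG; have subAG := mximage_closed A subG.
apply/zmod_closed_setP; split; first by split; exact: subgroup0.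
by move=> u v [Gu AGu] [Gv AGv]; split; exact: subgroupB.
Qed.

Lemma mximageM A B G : mximage A (mximage B G) = mximage (A *m B) G.
Proof.
apply/seteqP; split=> z.
  by move=> [_ [g Gg <-] <-]; exists g => //; rewrite mulmxA.
by move=> [g Gg <-]; exists (B *m g); [exists g|rewrite mulmxA].
Qed.

(** Two intersecting cosets of subgroups meet in a coset of the intersection;
the hypothesis on [A *m x - x] says that [x + l] is a common point. *)
Lemma translate_mximage_meet G A x l : zmod_closed (mem G) -> G l ->
  translate l (mximage A G) (A *m x - x) ->
  translate x G `&` mximage A (translate x G) = translate (x + l) (CSL G A).
Proof.
move=> subG Gl /translateP AGl; have subAG := mximage_closed A subG.
apply/seteqP; split=> z.
  move=> [/translateP Gz [_ [g Gg <-] defz]]; apply/translateP.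
  rewrite opprD addrA; split; first exact: subgroupB.
  have -> : z - x - l = A *m x - x - l + A *m g.
    by rewrite -defz mulmxDr [RHS]addrAC [in RHS](addrAC (A *m x)).
  by apply: subgroupD => //; exists g.
move/translateP; rewrite opprD addrA => -[Gz AGz]; split.
  by apply/translateP; rewrite -(subrK l (z - x)); exact: subgroupD.
have [g Gg defg] := subgroupB subAG AGz AGl.
exists (x + g); first by exists g.
by rewrite mulmxDr defg !opprB [LHS]addrC !addrA !subrK.
Qed.

End Cosets.

(** * Finite index and integer multiples *)

Section FiniteIndex.
Variables (R : realType) (d : nat).
Implicit Types (A B : 'M[R]_d) (G H : set 'cV[R]_d).

(** By the pigeonhole principle, two of the multiples 0, g, 2 g, ... lie in the
same coset as soon as there are more multiples than cosets, so that their
difference k g lies in [H].  The number k depends on [g], but is bounded by the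
length of a list of all cosets; hence it divides the factorial of that length,
which serves for every [g]. *)
Lemma finite_index_exponent G H :
  zmod_closed (mem G) -> zmod_closed (mem H) -> has_finite_index G H ->
  exists2 n, (0 < n)%N & forall g, G g -> H (g *+ n).
Proof.
move=> subG subH [_ /finite_seqP[s eqs]]; exists (size s)`!; first exact: fact_gt0.
move=> g Gg; pose coset k := translate (g *+ k) H.
have cosets_in_s : {subset map coset (iota 0 (size s).+1) <= s}.
  move=> _ /mapP[k _ ->].
  have : [set translate g0 H | g0 in G] (coset k).
    by exists (g *+ k) => //; exact: subgroupMn.
  by rewrite eqs.
have : ~~ uniq (map coset (iota 0 (size s).+1)).
  apply/negP => /uniq_leq_size /(_ cosets_in_s).
  by rewrite size_map size_iota ltnn.
move=> /(uniqPn set0)[i [j [ltij]]]; rewrite size_map size_iota => ltjs.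
have ltis := ltn_trans ltij ltjs.
rewrite !(nth_map 0) ?size_iota// !nth_iota// !add0n => /esym.
move=> /(translate_eqP _ _ subH); rewrite -mulrnBr; last exact: ltnW.
move=> Hg; have /dvdnP[q ->] : (j - i %| (size s)`!)%N.
  by apply: dvdn_fact; rewrite subn_gt0 ltij (leq_trans (leq_subr _ _)).
by rewrite mulnC mulrnA; exact: subgroupMn.
Qed.

Definition int_vectors : set 'cV[R]_d :=
  [set map_mx intr c | c in [set: 'cV[int]_d]].

Lemma lattice_basis_matrix G : is_lattice G ->
  exists2 B, B \in unitmx & G = mximage B int_vectors.
Proof.
move=> [b freeb ->]; pose B : 'M[R]_d := \matrix_(i, j) tnth b j i 0.
have mulB (v : 'cV[R]_d) : B *m v = \sum_(j < d) v j 0 *: tnth b j.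
  apply/colP => i; rewrite !mxE summxE; apply: eq_bigr => j _.
  by rewrite !mxE mulrC.
exists B.
  rewrite -unitmx_tr -row_free_unit; apply: inj_row_free => v vB0.
  apply/rowP => j; rewrite mxE.
  have /freeP/(_ (fun i => v 0 i)) := freeb; apply.
  transitivity (B *m v^T); last by rewrite -[B]trmxK -trmx_mul vB0 trmx0.
  by rewrite mulB; apply: eq_bigr => i _; rewrite mxE -tnth_nth.
apply/seteqP; split=> z.
  move=> [c _ <-]; exists (map_mx intr (\col_i c i)); first by eexists.
  by rewrite mulB; apply: eq_bigr => j _; rewrite !mxE scaler_int.
move=> [_ [c _ <-] <-]; exists (fun i => c i 0) => //.
by rewrite mulB; apply: eq_bigr => j _; rewrite !mxE scaler_int.
Qed.

Lemma int_vectors_closed : zmod_closed (mem int_vectors).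
Proof.
apply/zmod_closed_setP; split; first by exists 0 => //; rewrite map_mx0.
by move=> _ _ [u _ <-] [v _ <-]; exists (u - v); rewrite ?map_mxB.
Qed.

Lemma lattice_closed G : is_lattice G -> zmod_closed (mem G).
Proof.
by move=> /lattice_basis_matrix[B _ ->]; exact/mximage_closed/int_vectors_closed.
Qed.

(** If [B] and [C] have their columns generating [G] and [G'], then [n G <= G'] reads
[n B = C M] with [M] an integer matrix, and the adjugate inverts [M] over the
integers up to the factor [\det M].  As [n B] is invertible, so are [C] and [M],
and [\det M] is nonzero. *)
Lemma lattice_multiple_sym B C n : B \in unitmx -> (0 < n)%N ->
    (forall g, mximage B int_vectors g -> mximage C int_vectors (g *+ n)) ->
  exists2 m, (0 < m)%N &
    forall g, mximage C int_vectors g -> mximage B int_vectors (g *+ m).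
Proof.
move=> Bu n_gt0 subBC.
have colBC j : exists c : 'cV[int]_d, C *m map_mx intr c = col j B *+ n.
  have [|_ [c _ <-] <-] := subBC (col j B); last by exists c.
  exists (delta_mx j 0); last by rewrite colE.
  by exists (delta_mx j 0) => //; rewrite map_delta_mx.
have {colBC}[M defM] : exists M : 'M[int]_d, C *m map_mx intr M = B *+ n.
  have [f defM] := boolp.choice colBC.
  exists (\matrix_(i, j) f j i 0); apply/matrixP => i j.
  have /colP/(_ i) := defM j; rewrite !mulmxnE !mxE => <-.
  by apply: eq_bigr => k _; rewrite !mxE.
have detM : \det M != 0.
  have : (map_mx intr M : 'M[R]_d) \in unitmx.
    have : B *+ n \in unitmx.
      by rewrite -scaler_nat unitmxZ// unitfE pnatr_eq0 -lt0n.
    by rewrite -defM unitmx_mul => /andP[].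
  by rewrite unitmxE det_map_mx unitfE intr_eq0.
exists `|\det M|%N; first by rewrite absz_gt0.
move=> _ [_ [c _ <-] <-].
have adjM : C *m map_mx intr c *~ \det M =
            B *m map_mx intr ((\adj M *m c) *+ n).
  rewrite raddfMn/= -scaler_nat -scalemxAr scalemxAl scaler_nat -defM.
  rewrite -mulmxA -map_mxM mulmxA mul_mx_adj mul_scalar_mx.
  by rewrite map_mxZ -scalemxAr scaler_int.
have subB := mximage_closed B int_vectors_closed.
have Bdet : mximage B int_vectors (C *m map_mx intr c *~ \det M).
  by rewrite adjM; eexists; last by []; eexists.
move: Bdet; case: (\det M) => k // /(subgroupN subB).
by rewrite NegzE mulrNz opprK.
Qed.

(** Reducing coordinates modulo [n] shows that every coset of [H] has a
representative with coordinates between 0 and [n - 1]. *)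
Lemma finite_index_of_multiple B H n : zmod_closed (mem H) ->
    H `<=` mximage B int_vectors -> (0 < n)%N ->
    (forall g, mximage B int_vectors g -> H (g *+ n)) ->
  has_finite_index (mximage B int_vectors) H.
Proof.
move=> subH HB n_gt0 nB; split=> //.
pose rep (r : {ffun 'I_d -> 'I_n}) : set 'cV[R]_d :=
  translate (B *m map_mx intr (\col_i (r i : nat)%:Z)) H.
apply: (@sub_finite_set _ _ (range rep)); last exact/finite_image/finite_finset.
move=> _ [_ [_ [c _ <-] <-] <-].
have ltr i : (`|(c i ord0 %% n)%Z|%N < n)%N.
  rewrite -ltz_nat gez0_abs ?modz_ge0 -?lt0n//.
  by rewrite ltz_pmod// ltz_nat.
exists [ffun i => Ordinal (ltr i)] => //; apply/esym/(translate_eqP _ _ subH).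
rewrite -mulmxBr -map_mxB.
have -> : c - \col_i ([ffun i => Ordinal (ltr i)] i : nat)%:Z =
          (\col_i (c i ord0 %/ n)%Z) *+ n.
  apply/colP => i; rewrite mulmxnE !mxE ffunE/= gez0_abs ?modz_ge0 -?lt0n//.
  by rewrite {1}(divz_eq (c i ord0) n) addrK -mulr_natr natz.
rewrite raddfMn/= -scaler_nat -scalemxAr scaler_nat.
by apply: nB; eexists; last by []; eexists.
Qed.

(** A group of finite index in [G] contains a positive multiple of [G].  As it
lies in [mximage A G], the latter has full rank, and [lattice_multiple_sym]
provides a multiple of it inside [G]. *)
Lemma CSL_finite_index_image G A : is_lattice G ->
  has_finite_index G (CSL G A) -> has_finite_index (mximage A G) (CSL G A).
Proof.
move=> latG finG; have subG := lattice_closed latG.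
have subCSL := CSL_closed A subG; have subAG := mximage_closed A subG.
have [B Bu defG] := lattice_basis_matrix latG.
have defAG : mximage A G = mximage (A *m B) int_vectors by rewrite defG mximageM.
have [n n_gt0 nG] := finite_index_exponent subG subCSL finG.
have [|m m_gt0 mAG] := @lattice_multiple_sym B (A *m B) n Bu n_gt0.
  by move=> g; rewrite -defG -defAG => /nG[].
rewrite -defG -defAG in mAG.
rewrite {1}defAG; apply: (finite_index_of_multiple subCSL _ m_gt0); rewrite -defAG.
  by move=> z [].
by move=> g AGg; split; [exact: mAG|exact: subgroupMn].
Qed.

End FiniteIndex.

(** * Coincidence isometries of shifted lattices *)

Theorem theorem4p3 (R : realType) (d : nat) (G : set 'cV[R]_d) (x : 'cV[R]_d)
    (latG : is_lattice G) :
  OC_shifted x G =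
    [set A | OC G A /\ sumset G (mximage A G) (A *m x - x)]
  /\
  (forall (A : 'M[R]_d) (l : 'cV[R]_d),
     OC_shifted x G A -> G l -> translate l (mximage A G) (A *m x - x) ->
     translate x G `&` mximage A (translate x G) =
       translate (x + l) (CSL G A)).
Proof.
have subG := lattice_closed latG.
split; last by move=> A l _ Gl AGl; exact: translate_mximage_meet.
apply/seteqP; split=> A.
  move=> [orthA [l [H [Gl [subH finH] meetE]]]].
  (* [H] contains [0], so [x + l] is a common point of [x + G] and [A (x + G)]. *)
  have [_ [_ [g Gg <-] defxl]] :
      (translate x G `&` mximage A (translate x G)) (x + l).
    rewrite meetE translateD; apply/translateP.
    by rewrite subrr; exact: subgroup0.
  have Axx : A *m x - x = l + A *m - g.
    apply/eqP; rewrite mulmxN subr_eq addrAC eq_sym subr_eq eq_sym.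
    by rewrite -mulmxDr defxl addrC.
  have AGl : translate l (mximage A G) (A *m x - x).
    by rewrite Axx; exists (A *m - g) => //; exists (- g) => //; exact: subgroupN.
  have defH : H = CSL G A.
    move: meetE; rewrite (translate_mximage_meet subG Gl AGl) translateD.
    by move=> /translate_inj.
  rewrite defH in finH; split; last by case: AGl => h AGh <-; exists l => //; exists h.
  split=> //; exact: CSL_finite_index_image.
move=> [[orthA finG _] [l Gl [h AGh defl]]]; split=> //.
have AGl : translate l (mximage A G) (A *m x - x) by exists h.
exists l, (CSL G A); split=> //; first by split=> //; exact: CSL_closed.
by rewrite translateD; exact: translate_mximage_meet.
Qed.
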